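(* Let $p$ be a prime, $n\ge1$, $q=p^n$. Let $L\in\mathbb{F}_q[x]$ be a monic $p$-linearized polynomial that divides $x^q-x$ and let $f\in\mathbb{F}_q[x]$ be a polynomial such that $L(f(L(y)))=0$ for every $y\in\mathbb{F}_q$. Then $P(x)=f(L(x))+x$ permutes $\mathbb{F}_q$. Moreover, if $t$ denotes the number of distinct roots of $f$ in the set $L(\mathbb{F}_q)$, then, as a permutation of $\mathbb{F}_q$, $P$ decomposes into $t\cdot\deg(L)$ cycles of length $1$ and $\frac{q-t\cdot\deg(L)}{p}$ cycles of length $p$.
   Context: A $p$-linearized polynomial is a polynomial of the form $\sum_{i=0}^m a_i x^{p^i}$. $L(\mathbb{F}_q)=\{L(y):y\in\mathbb{F}_q\}$; $t$ is the number of elements $\alpha\in L(\mathbb{F}_q)$ with $f(\alpha)=0$. *)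

(* Defs.v *)
From HB Require Import structures.
From mathcomp Require Import all_boot all_order all_fingroup all_algebra.

Set Implicit Arguments.
Unset Strict Implicit.
Unset Printing Implicit Defensive.

Import GRing.Theory.
Local Open Scope ring_scope.

Definition p_linearized (R : nzRingType) (p : nat) (L : {poly R}) : Prop :=
  exists (m : nat) (a : nat -> R), L = \sum_(0 <= i < m.+1) a i *: 'X^(p ^ i).

Definition degree (R : nzRingType) (P : {poly R}) : nat := (size P).-1.

Definition value_set (F : finFieldType) (L : {poly F}) : {set F} :=
  [set L.[y] | y in [set: F]].

Definition roots_in (F : finFieldType) (f : {poly F}) (A : {set F}) : {set F} :=
  [set a in A | root f a].

Definition permutes (F : finFieldType) (P : {poly F}) : Prop :=
  bijective (fun x : F => P.[x]).

(* The cycles of s, fixed points included, are its orbits. *)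
Definition num_cycles (T : finType) (s : {perm T}) (k : nat) : nat :=
  #|[set C in porbits s | #|C| == k]|.

(* Main.v *)
Require Import Defs.
From HB Require Import structures.
From mathcomp Require Import all_boot all_order all_fingroup all_algebra.
From mathcomp Require Import cyclic finfield.

(** The polynomial [P = f(L(x)) + x] translates each point [x] by
    [c(x) = f(L(x))].  The map [y |-> L.[y]] is additive because the field has
    characteristic [p], so the hypothesis [L(f(L(y))) = 0] says that
    [L(P(x)) = L(x)]: [P] preserves the fibres of [L], and on each fibre the
    translation vector [c] is constant.

    Everything follows from this.  If [P(x) = P(y)] then [L(x) = L(y)], hence
    [c(x) = c(y)] and [x = y]; so [P] is a permutation.  Its [k]-th iterate is
    [x |-> x + k c(x)], so its [p]-th power is the identity and its cycles have
    length [1] or [p].  The cycles of length [1] are the points with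
    [f(L(x)) = 0], that is, the fibres of [L] above the [t] roots of [f] in the
    image of [L].  Each such fibre is a translate of the kernel of [L], which
    has [deg L] elements because [L] divides the split separable polynomial
    [x^q - x].  The remaining [q - t deg L] points are shared out in cycles of
    length [p]. *)

Set Implicit Arguments.
Unset Strict Implicit.
Unset Printing Implicit Defensive.

Import GRing.Theory.
Local Open Scope ring_scope.

Lemma porbit_orbit (T : finType) (s : {perm T}) (x : T) :
  porbit s x = orbit 'P <[s]>%g x.
Proof. by rewrite porbit.unlock. Qed.

(** The orbits of size [k] partition the points whose orbit has size [k], which
    reduces counting cycles to counting points. *)
Lemma num_cyclesM (T : finType) (s : {perm T}) (k : nat) :
  (num_cycles s k * k)%N = #|[set x | #|porbit s x| == k]|.
Proof.
rewrite /num_cycles -(@card_uniform_partition _ k _ [set x | #|porbit s x| == k]) //.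
  by move=> C; rewrite inE => /andP[_ /eqP].
have sub_orbits : [set C in porbits s | #|C| == k] \subset porbits s.
  by apply/subsetP => C; rewrite inE => /andP[].
have /and3P[_ triv_orbits orbits_n0] : partition (porbits s) [set: T].
  have -> : porbits s = orbit 'P <[s]>%g @: [set: T].
    apply/setP => C; apply/imsetP/imsetP => -[x _ ->]; exists x;
      by rewrite ?inE ?porbit_orbit.
  by apply: orbit_partition; apply/actsP => a _ x; rewrite !inE.
apply/and3P; split; last 2 first.
- exact: trivIsetS triv_orbits.
- by apply: contra orbits_n0; apply: (subsetP sub_orbits).
apply/eqP/setP => x; rewrite inE; apply/bigcupP/idP => [[C]|xk]; last first.
  by exists (porbit s x); rewrite ?porbit_id // inE xk imset_f.
by rewrite inE => /andP[/imsetP[y _ ->] yk]; rewrite -eq_porbit_mem => /eqP->.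
Qed.

Lemma card_porbit_eq1 (T : finType) (s : {perm T}) (x : T) :
  (#|porbit s x| == 1%N) = (s x == x).
Proof.
apply/cards1P/eqP => [[y orbE]|sx].
  have := mem_porbit s 1 x; have := porbit_id s x.
  by rewrite orbE !inE expg1 => /eqP-> /eqP.
exists x; apply/setP => y; rewrite inE; apply/porbitP/eqP => [[i ->]|->].
  by rewrite permX; elim: i => //= i ->.
by exists 0%N; rewrite expg0 perm1.
Qed.

(** The size of an orbit is the index of a stabilizer in the cyclic group
    generated by [s], so it divides the order of [s], hence [p]. *)
Lemma card_porbit_prime_order (T : finType) (s : {perm T}) (p : nat) :
    prime p -> (s ^+ p)%g = 1%g ->
  forall C : {set T}, C \in porbits s -> #|C| = 1%N \/ #|C| = p.
Proof.
move=> p_prime sp1 C /imsetP[x _ ->].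
have : (#|porbit s x| %| p)%N.
  by rewrite porbit_orbit card_orbit (dvdn_trans (dvdn_indexg _ _)) // order_dvdn sp1.
by case/primeP: p_prime => _ /[apply] /orP[] /eqP; [left | right].
Qed.

Lemma num_cycles_fixed (T : finType) (s : {perm T}) :
  num_cycles s 1 = #|[set x | s x == x]|.
Proof.
rewrite -[LHS]muln1 num_cyclesM; congr #|pred_of_set _|.
by apply/setP => x; rewrite !inE card_porbit_eq1.
Qed.

Lemma num_cycles_prime_order (T : finType) (s : {perm T}) (p : nat) :
    prime p -> (s ^+ p)%g = 1%g ->
  (num_cycles s p * p)%N = (#|T| - #|[set x | s x == x]|)%N.
Proof.
move=> p_prime sp1; rewrite num_cyclesM.
rewrite -(cardsC [set x | s x == x]) addKn.
congr #|pred_of_set _|; apply/setP => x; rewrite !inE -card_porbit_eq1.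
have [->|->] := card_porbit_prime_order p_prime sp1 (imset_f (porbit s) (isT : x \in T)).
  by rewrite eqxx (ltn_eqF (prime_gt1 p_prime)).
by rewrite eqxx (gtn_eqF (prime_gt1 p_prime)).
Qed.

(** Each monomial of [L] acts as a power of the Frobenius endomorphism, up to
    a scalar. *)
Lemma p_linearizedD (R : comNzRingType) (p : nat) (L : {poly R}) :
    p \in [pchar R] -> p_linearized p L ->
  {morph (fun x => L.[x]) : x y / x + y}.
Proof.
move=> charRp [m [a ->]] x y /=; rewrite !horner_sum -big_split /=.
apply: eq_bigr => i _; rewrite !hornerZ !hornerXn -mulrDr exprDn_pchar //.
by rewrite pnatX (pnatE _ (pcharf_prime charRp)) charRp.
Qed.

(** A divisor of [x^q - x] is, up to a scalar, a product of distinct linear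
    factors. *)
Lemma card_roots_dvd_genPoly (F : finFieldType) (L : {poly F}) :
  L %| 'X^#|F| - 'X -> #|[set x | L.[x] == 0]| = degree L.
Proof.
rewrite finField_genPoly => /dvdp_prod_XsubC[m].
set r := mask m _ => eqL.
have r_uniq : uniq r by rewrite mask_uniq // index_enum_uniq.
rewrite /degree (eqp_size eqL) size_prod_XsubC /= -(card_uniqP r_uniq).
apply: eq_card => x; rewrite inE -rootE (eqp_root eqL) root_prod_XsubC //.
Qed.

(** The fibre through [y] is the translate of the kernel by [y]. *)
Lemma card_fibre_morph (U V : finZmodType) (g : U -> V) (y : U) :
    {morph g : x y / x + y} ->
  #|[set x | g x == g y]| = #|[set x | g x == 0]|.
Proof.
move=> gD; rewrite -[RHS](card_imset _ (addrI y)); apply: eq_card => x.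
rewrite inE; apply/eqP/imsetP => [gxy|[z /[!inE] /eqP gz ->]].
  exists (x - y); last by rewrite addrC subrK.
  by rewrite inE -(inj_eq (addIr (g y))) -gD subrK gxy add0r.
by rewrite gD gz addr0.
Qed.

(** The roots of the composite are the union of the fibres of [L] above the
    roots of [f] in the image of [L], and all fibres have the size of the
    kernel. *)
Lemma card_roots_comp (F : finFieldType) (f L : {poly F}) :
    {morph (fun x => L.[x]) : x y / x + y} ->
  #|[set x | f.[L.[x]] == 0]| =
    (#|roots_in f (value_set L)| * #|[set x | L.[x] == 0%R]|)%N.
Proof.
move=> LD; rewrite -sum1_card.
rewrite (partition_big (fun x => L.[x]) [in roots_in f (value_set L)]) /=; last first.
  by move=> x; rewrite !inE rootE => ->; rewrite imset_f.
rewrite -sum_nat_const; apply: eq_bigr => a /[!inE] /andP[/imsetP[y _ ->] fy].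
rewrite -(card_fibre_morph y LD) -sum1_card; apply: eq_bigl => x; rewrite !inE.
by case: (L.[x] =P L.[y]) => [->|]; rewrite (andbT, andbF) // -rootE fy.
Qed.

(** The vector [c] keeps the same value along the orbit of [x], so each step
    adds the same [c x]. *)
Lemma iter_translation (V : nmodType) (s c : V -> V) (x : V) (k : nat) :
    (forall x, s x = x + c x) -> (forall x, c (s x) = c x) ->
  iter k s x = x + c x *+ k.
Proof.
move=> sE cs; have ck i : c (iter i s x) = c x by elim: i => //= i; rewrite cs.
by elim: k => [|k IHk]; rewrite ?mulr0n ?addr0 //= sE ck IHk -addrA -mulrSr.
Qed.

Theorem theorem5p4 (p n : nat) (F : finFieldType) (L f : {poly F})
    (p_prime : prime p) (n_ge1 : (1 <= n)%N) (cardF : #|F| = (p ^ n)%N)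
    (L_monic : L \is monic) (L_lin : p_linearized p L)
    (L_dvd : L %| 'X^(p ^ n) - 'X)
    (LfL : forall y : F, L.[f.[L.[y]]] = 0) :
  let q := (p ^ n)%N in
  let P : {poly F} := (f \Po L) + 'X in
  let t := #|roots_in f (value_set L)| in
  permutes P /\
  exists s : {perm F},
    [/\ forall x : F, s x = P.[x],
        forall C : {set F}, C \in porbits s -> #|C| = 1%N \/ #|C| = p,
        num_cycles s 1 = (t * degree L)%N,
        (t * degree L <= q)%N /\ (p %| q - t * degree L)%N
      & num_cycles s p = ((q - t * degree L) %/ p)%N].
Proof.
move=> q P t.
have charFp : p \in [pchar F] := card_finPcharP cardF p_prime.
have LD := p_linearizedD charFp L_lin.
have PE x : P.[x] = x + f.[L.[x]] by rewrite hornerD horner_comp hornerX addrC.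
have LP x : L.[P.[x]] = L.[x] by rewrite PE LD LfL addr0.
have P_inj : injective (fun x => P.[x]).
  move=> x y /= Pxy; have Lxy : L.[x] = L.[y] by rewrite -LP Pxy LP.
  by move: Pxy; rewrite !PE Lxy => /addIr.
split; first exact: injF_bij.
pose s := perm P_inj; have sE x : s x = P.[x] by rewrite permE.
have sp1 : (s ^+ p)%g = 1%g.
  apply/permP => x; rewrite permX perm1.
  rewrite (@iter_translation _ _ (fun x => f.[L.[x]])) => [|z|z].
  - by rewrite -mulr_natr (pcharf0 charFp) mulr0 addr0.
  - by rewrite sE PE.
  - by rewrite sE LP.
have fixE : #|[set x | s x == x]| = (t * degree L)%N.
  rewrite -(card_roots_dvd_genPoly (L := L)) ?cardF // -(card_roots_comp f LD).
  apply: eq_card => x; rewrite !inE sE PE.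
  by rewrite -[X in _ == X]addr0 (inj_eq (addrI x)).
have cycpE : (num_cycles s p * p)%N = (q - t * degree L)%N.
  by rewrite (num_cycles_prime_order p_prime sp1) cardF fixE.
exists s; split=> //.
- exact: card_porbit_prime_order.
- by rewrite num_cycles_fixed.
- by rewrite -cycpE dvdn_mull // -fixE /q -cardF max_card.
- by rewrite -cycpE mulnK // prime_gt0.
Qed.
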